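(* Let $(\mathbb{E},\langle\,,\rangle,\rho,[\,,])$ be a regular metric algebroid over $M$. It is a curved Courant algebroid if and only if there is $T\in\Omega^2(M,TM)$ such that $F(a,b)=T(\rho(a),\rho(b))$ for all $a,b\in\Gamma(\mathbb{E})$. If the curved Courant algebroid is, in addition, transitive, such $T$ is unique.
   Context: Everything is smooth. A tuple $(\mathbb{E},\langle\,,\rangle,\rho,[\,,])$ over $M$ consists of a vector bundle $\mathbb{E}\to M$, a non-degenerate symmetric pairing $\langle\,,\rangle\in\Gamma(\mathrm{Sym}^2\mathbb{E}^* )$, a vector bundle morphism $\rho:\mathbb{E}\to TM$ over $\mathrm{id}_M$ (the anchor), and an $\mathbb{R}$-bilinear bracket on $\Gamma(\mathbb{E})$. Define $\rho^*:T^*M\to\mathbb{E}$ by $\langle\rho^*\alpha,b\rangle=\alpha(\rho(b))$. A metric algebroid is a tuple with $[a,b]+[b,a]=\rho^*d\langle a,b\rangle$ and $\rho(a)\langle b,c\rangle=\langle[a,b],c\rangle+\langle b,[a,c]\rangle$ for all $a,b,c\in\Gamma(\mathbb{E})$. Put $F(a,b):=\rho([a,b])-[\rho(a),\rho(b)]_{\mathrm{Lie}}$. A metric algebroid is a curved Courant algebroid if $F$ is $C^\infty(M)$-bilinear and skew-symmetric, i.e. $F\in\Gamma(\wedge^2\mathbb{E}^*\otimes TM)$, and $F(a,b)=0$ whenever $a\in\ker\rho$ (pointwise). A tuple is regular if $\rho$ has constant rank, and transitive if $\rho$ is surjective. *)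

(* Defs.v *)
From HB Require Import structures.
From mathcomp Require Import all_boot all_order all_algebra.
From mathcomp Require Import all_classical all_reals all_analysis.
From mathcomp Require Import ring.
Set Implicit Arguments.
Unset Strict Implicit.
Unset Printing Implicit Defensive.
Import Order.TTheory GRing.Theory Num.Theory.
Import numFieldNormedType.Exports.
Local Open Scope classical_set_scope.
Local Open Scope ring_scope.

(* Meant for [U] open: all iterated directional derivatives of [f] up to
   order [k] exist at the points of [U] and are continuous there. *)
Fixpoint Ck (R : realType) (n k : nat) (U : set 'rV[R]_n) (f : 'rV[R]_n -> R)
    : Prop :=
  (forall x, U x -> {for x, continuous f}) /\
  match k with
  | 0%N => True
  | k'.+1 => forall v : 'rV[R]_n,
      (forall x, U x -> derivable f x v) /\ Ck k' U ('D_v f)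
  end.

Definition Cinfty (R : realType) (n : nat) (U : set 'rV[R]_n)
    (f : 'rV[R]_n -> R) : Prop := forall k, Ck k U f.

Section Ck_theory.
Variables (R : realType) (n : nat).
Implicit Types (U V : set 'rV[R]_n) (f g : 'rV[R]_n -> R).

Lemma Ck_subset k U V f : V `<=` U -> Ck k U f -> Ck k V f.
Proof.
move=> VU; elim: k f => [|k IH] f /= [cf df]; split => //.
- by move=> x /VU /cf.
- by move=> x /VU /cf.
move=> v; have [d1 d2] := df v; split; last exact: IH.
by move=> x /VU /d1.
Qed.

Lemma Ck_continuous k U f : Ck k U f -> forall x, U x -> {for x, continuous f}.
Proof. by case: k => [|k] []. Qed.

Lemma CkS k U f : Ck k.+1 U f -> Ck k U f.
Proof.
elim: k f => [|k IH] f; first by case.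
move=> [cf df]; split=> // v; have [d1 d2] := df v; split=> //; exact: IH.
Qed.

Lemma eq_Ck k U f g : open U -> (forall x, U x -> f x = g x) ->
  Ck k U f -> Ck k U g.
Proof.
move=> oU; elim: k f g => [|k IH] f g fg.
  move=> [cf _]; split=> // x Ux.
  have nfg : \forall y \near x, f y = g y.
    by apply: filterS fg _; exact: open_nbhs_nbhs.
  rewrite /prop_for /continuous_at -(fg x Ux).
  apply: cvg_trans (near_eq_cvg nfg) _; exact: cf.
move=> Cf; have cf := Ck_continuous Cf; case: Cf => _ df.
have nfg x : U x -> \forall y \near x, f y = g y.
  by move=> Ux; apply: filterS fg _; exact: open_nbhs_nbhs.
split=> [x Ux|v].
  rewrite /prop_for /continuous_at -(fg x Ux).
  apply: cvg_trans (near_eq_cvg (nfg _ Ux)) _; exact: cf.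
have [d1 d2] := df v; split=> [x Ux|].
  by apply: near_eq_derivable (d1 _ Ux); apply: filterS (nfg _ Ux).
by apply: IH d2 => x Ux; apply: near_eq_derive; exact: nfg.
Qed.

Lemma Ck_cst k U (c : R) : Ck k U (fun=> c).
Proof.
have cc (a : R) x : {for x, continuous (fun _ : 'rV[R]_n => a)}.
  exact: cst_continuous.
elim: k c => [|k IH] c; first by split.
split=> // v; have -> : 'D_v (fun=> c) = (fun=> 0) :> ('rV[R]_n -> R).
  by apply/funext => x; exact: derive_cst.
by split=> [x _|]; [exact: derivable_cst|exact: IH].
Qed.

Lemma CkD k U f g : open U -> Ck k U f -> Ck k U g ->
  Ck k U (fun x => f x + g x).
Proof.
move=> oU; elim: k f g => [|k IH] f g /= [cf df] [cg dg].
  by split=> // x Ux; apply: continuousD; [exact: cf|exact: cg].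
split=> [x Ux|v]; first by apply: continuousD; [exact: cf|exact: cg].
have [df1 df2] := df v; have [dg1 dg2] := dg v; split=> [x Ux|].
  by apply: derivableD; [exact: df1|exact: dg1].
apply: eq_Ck oU _ (IH _ _ df2 dg2) => x Ux.
by rewrite -deriveD//; [exact: df1|exact: dg1].
Qed.

Lemma CkM k U f g : open U -> Ck k U f -> Ck k U g ->
  Ck k U (fun x => f x * g x).
Proof.
move=> oU; elim: k f g => [|k IH] f g.
  move=> [cf _] [cg _].
  by split=> // x Ux; apply: continuousM; [exact: cf|exact: cg].
move=> Cf Cg; have /CkS Cf' := Cf; have /CkS Cg' := Cg.
case: Cf Cg => [cf df] [cg dg].
split=> [x Ux|v]; first by apply: continuousM; [exact: cf|exact: cg].
have [df1 df2] := df v; have [dg1 dg2] := dg v; split=> [x Ux|].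
  by apply: derivableM; [exact: df1|exact: dg1].
apply: eq_Ck oU _ (CkD oU (IH _ _ Cf' dg2) (IH _ _ Cg' df2)) => x Ux.
by apply/esym/deriveM; [exact: df1|exact: dg1].
Qed.

End Ck_theory.

(* [chart_map] and [chart_inv] are total functions, relevant only on
   [chart_dom] and [chart_codom]. *)
Record chart (R : realType) (n : nat) (M : topologicalType) := Chart {
  chart_dom : set M ;
  chart_codom : set 'rV[R]_n ;
  chart_map : M -> 'rV[R]_n ;
  chart_inv : 'rV[R]_n -> M ;
  chart_dom_open : open chart_dom ;
  chart_codom_open : open chart_codom ;
  chart_mapP : forall p, chart_dom p -> chart_codom (chart_map p) ;
  chart_invP : forall x, chart_codom x -> chart_dom (chart_inv x) ;
  chart_mapK : forall p, chart_dom p -> chart_inv (chart_map p) = p ;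
  chart_invK : forall x, chart_codom x -> chart_map (chart_inv x) = x ;
  chart_map_continuous : forall p, chart_dom p ->
    {for p, continuous chart_map} ;
  chart_inv_continuous : forall x, chart_codom x ->
    {for x, continuous chart_inv} }.

(* The image of [U `&` chart_dom c] under the chart. *)
Definition chart_image (R : realType) (n : nat) (M : topologicalType)
    (c : chart R n M) (U : set M) : set 'rV[R]_n :=
  [set x | chart_codom c x /\ U (chart_inv c x)].

(* The atlas need not be maximal. *)
Record manifold (R : realType) (n : nat) := Manifold {
  manifold_space :> topologicalType ;
  manifold_hausdorff : hausdorff_space manifold_space ;
  manifold_second_countable : @second_countable manifold_space ;
  manifold_atlas : set (chart R n manifold_space) ;
  manifold_atlas_cover : forall p,
    exists2 c, manifold_atlas c & chart_dom c p ;
  manifold_atlas_smooth : forall c d,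
    manifold_atlas c -> manifold_atlas d -> forall i : 'I_n,
    Cinfty (chart_image c (chart_dom d))
      (fun x => chart_map d (chart_inv c x) 0 i) }.

Lemma chart_image_open (R : realType) (n : nat) (M : topologicalType)
  (c : chart R n M) (U : set M) : open U -> open (chart_image c U).
Proof.
move=> oU; rewrite openE => x [cx Ux]; rewrite /interior.
have oc : open (chart_codom c) by exact: chart_codom_open.
have h : \forall y \near x, U (chart_inv c y).
  by have /(_ U) := chart_inv_continuous cx; apply; exact: open_nbhs_nbhs.
near=> y; split; near: y => //; exact: open_nbhs_nbhs.
Unshelve. all: by end_near. Qed.

Section SmoothFunctions.
Variables (R : realType) (n : nat) (M : manifold R n).

(* Meant for [U] open. *)
Definition smooth_on (U : set M) (f : M -> R) : Prop :=
  forall c, manifold_atlas c ->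
    Cinfty (chart_image c U) (fun x => f (chart_inv c x)).

Lemma smooth_on_subset (U V : set M) f :
  V `<=` U -> smooth_on U f -> smooth_on V f.
Proof.
move=> VU sf c ac k; apply: Ck_subset (sf c ac k).
by move=> x [cx /VU].
Qed.

Lemma smooth_on_cst (U : set M) a : smooth_on U (fun=> a).
Proof. by move=> c _ k; exact: Ck_cst. Qed.

Lemma smooth_onD (U : set M) f g : open U -> smooth_on U f -> smooth_on U g ->
  smooth_on U (fun p => f p + g p).
Proof.
move=> oU sf sg c ac k.
by apply: CkD (sf c ac k) (sg c ac k); exact: chart_image_open.
Qed.

Lemma smooth_onM (U : set M) f g : open U -> smooth_on U f -> smooth_on U g ->
  smooth_on U (fun p => f p * g p).
Proof.
move=> oU sf sg c ac k.
by apply: CkM (sf c ac k) (sg c ac k); exact: chart_image_open.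
Qed.

Lemma smooth_onB (U : set M) f g : open U -> smooth_on U f -> smooth_on U g ->
  smooth_on U (fun p => f p - g p).
Proof.
move=> oU sf sg.
have := smooth_onD oU sf (smooth_onM oU (@smooth_on_cst U (-1)) sg).
by congr smooth_on; apply/funext => p; rewrite mulN1r.
Qed.

Definition smooth_fun : {pred M -> R} := fun f => `[< smooth_on setT f >].

Lemma smooth_fun_subring : subring_closed smooth_fun.
Proof.
split; first by apply/asboolP; exact: smooth_on_cst.
- move=> f g /asboolP sf /asboolP sg; apply/asboolP.
  by apply: smooth_onB => //; exact: openT.
- move=> f g /asboolP sf /asboolP sg; apply/asboolP.
  by apply: smooth_onM => //; exact: openT.
Qed.

HB.instance Definition _ :=
  GRing.isSubringClosed.Build (M -> R) smooth_fun smooth_fun_subring.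

Record Cinf := MkCinf { Cinf_val :> M -> R ; _ : Cinf_val \in smooth_fun }.

HB.instance Definition _ := [isSub for Cinf_val].
HB.instance Definition _ := [Choice of Cinf by <:].
HB.instance Definition _ := GRing.SubChoice_isSubComPzRing.Build
  (M -> R) smooth_fun Cinf smooth_fun_subring.

Lemma CinfP (f : Cinf) : smooth_on setT f.
Proof. by case: f => f /= /asboolP. Qed.

Definition mkCinf (f : M -> R) (sf : smooth_on setT f) : Cinf :=
  MkCinf (asboolT sf).

Definition constC (a : R) : Cinf := mkCinf (@smooth_on_cst setT a).

End SmoothFunctions.
Arguments Cinf {R n} M.
Arguments constC {R n M} a.

Section Tangent.
Variables (R : realType) (n : nat) (M : manifold R n).

(* The tangent space at [p] is the space of derivations at [p] of C^oo(M). *)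
Definition derivation_at (p : M) : {pred (Cinf M -> R^o)} := fun v =>
  `[< (forall (a : R) (f g : Cinf M),
         v (constC a * f + g) = a * v f + v g) /\
      (forall f g : Cinf M, v (f * g) = f p * v g + g p * v f) >].

Lemma derivation_at_submod (p : M) : submod_closed (derivation_at p).
Proof.
split.
  apply/asboolP; split=> [a f g|f g]; rewrite /GRing.zero /=.
    by rewrite mulr0 addr0.
  by rewrite !mulr0 addr0.
move=> a u v /asboolP [ul uL] /asboolP [vl vL]; apply/asboolP.
have E f : (a *: u + v) f = a * u f + v f by [].
split=> [b f g|f g]; rewrite !E.
  rewrite ul vl !mulrDr !mulrA [a * b]mulrC !addrA; congr (_ + _).
  by rewrite -!addrA; congr (_ + _); rewrite addrC.
rewrite uL vL !mulrDr !mulrA [a * f p]mulrC [a * g p]mulrC !addrA.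
congr (_ + _).
by rewrite -!addrA; congr (_ + _); rewrite addrC.
Qed.

HB.instance Definition _ (p : M) :=
  GRing.isSubmodClosed.Build R (Cinf M -> R^o) (derivation_at p)
    (GRing.submod_closed_semi (derivation_at_submod p)).

Record tangent (p : M) :=
  MkTangent { tangent_val :> Cinf M -> R^o ;
              _ : tangent_val \in derivation_at p }.

HB.instance Definition _ (p : M) := [isSub for @tangent_val p].
HB.instance Definition _ (p : M) := [Choice of tangent p by <:].
HB.instance Definition _ (p : M) := [SubChoice_isSubLmodule of tangent p by <:].
End Tangent.
Arguments tangent {R n M} p.

(* Dependent functions, i.e. not necessarily smooth sections of the family [V],
   with pointwise operations. *)
Definition rough (T : Type) (V : T -> zmodType) := forall p, V p.

Section Rough.
Variables (T : Type) (V : T -> zmodType).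
HB.instance Definition _ := gen_eqMixin (rough V).
HB.instance Definition _ := gen_choiceMixin (rough V).

Let rough_ext (a b : rough V) : (forall p, a p = b p) -> a = b.
Proof. exact: functional_extensionality_dep. Qed.
Let add (a b : rough V) : rough V := fun p => a p + b p.
Let opp (a : rough V) : rough V := fun p => - a p.
Let zero : rough V := fun=> 0.
Let addA : associative add.
Proof. by move=> a b c; apply/rough_ext => p; exact: addrA. Qed.
Let addC : commutative add.
Proof. by move=> a b; apply/rough_ext => p; exact: addrC. Qed.
Let add0 : left_id zero add.
Proof. by move=> a; apply/rough_ext => p; exact: add0r. Qed.
Let addN : left_inverse zero opp add.
Proof. by move=> a; apply/rough_ext => p; exact: addNr. Qed.

HB.instance Definition _ :=
  GRing.isZmodule.Build (rough V) addA addC add0 addN.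
End Rough.

Section VectorField.
Variables (R : realType) (n : nat) (M : manifold R n).

Lemma tangentDE (p : M) (u v : tangent p) (f : Cinf M) : (u + v) f = u f + v f.
Proof. by []. Qed.

Lemma tangentNE (p : M) (u : tangent p) (f : Cinf M) : (- u) f = - u f.
Proof. by []. Qed.

Lemma tangentBE (p : M) (u v : tangent p) (f : Cinf M) : (u - v) f = u f - v f.
Proof. by []. Qed.

Lemma tangentZE (p : M) a (u : tangent p) (f : Cinf M) : (a *: u) f = a * u f.
Proof. by []. Qed.

Definition smooth_vf : {pred rough (fun p : M => tangent p)} := fun X =>
  `[< forall f : Cinf M, smooth_on setT (fun p => X p f) >].

Lemma smooth_vf_zmod : zmod_closed smooth_vf.
Proof.
split; first by apply/asboolP => f; exact: smooth_on_cst.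
move=> X Y /asboolP sX /asboolP sY; apply/asboolP => f.
by apply: smooth_onB; [exact: openT|exact: sX|exact: sY].
Qed.

HB.instance Definition _ := GRing.isZmodClosed.Build
  (rough (fun p : M => tangent p)) smooth_vf smooth_vf_zmod.

Record vector_field := MkVectorField {
  vf_val : rough (fun p : M => tangent p) ; _ : vf_val \in smooth_vf }.

Definition vf_at (X : vector_field) (p : M) : tangent p := vf_val X p.
Coercion vf_at : vector_field >-> Funclass.

HB.instance Definition _ := [isSub for vf_val].
HB.instance Definition _ := [Choice of vector_field by <:].
HB.instance Definition _ := [SubChoice_isSubZmodule of vector_field by <:].

Lemma vfP (X : vector_field) (f : Cinf M) : smooth_on setT (fun p => X p f).
Proof. by case: X => X /= /asboolP. Qed.

Definition mkVectorField (X : forall p : M, tangent p)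
    (sX : forall f : Cinf M, smooth_on setT (fun p => X p f)) : vector_field :=
  @MkVectorField X (asboolT sX).

Definition scale_vf (f : Cinf M) (X : vector_field) : vector_field :=
  @mkVectorField (fun p => f p *: X p)
    (fun g => smooth_onM openT (CinfP f) (vfP X g)).

Lemma vf_ext (X Y : vector_field) : (forall p, X p = Y p) -> X = Y.
Proof. by move=> XY; apply/val_inj/functional_extensionality_dep. Qed.

Fact scale_vfA (f g : Cinf M) X :
  scale_vf f (scale_vf g X) = scale_vf (f * g) X.
Proof. by apply: vf_ext => p; exact: scalerA. Qed.
Fact scale_vf1 : left_id 1 scale_vf.
Proof. by move=> X; apply: vf_ext => p; exact: scale1r. Qed.
Fact scale_vfDr : right_distributive scale_vf +%R.
Proof. by move=> f X Y; apply: vf_ext => p; exact: scalerDr. Qed.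
Fact scale_vfDl X : {morph scale_vf^~ X : f g / f + g}.
Proof. by move=> f g; apply: vf_ext => p; exact: scalerDl. Qed.

HB.instance Definition _ := GRing.Zmodule_isLmodule.Build (Cinf M) vector_field
  scale_vfA scale_vf1 scale_vfDr scale_vfDl.

(* The derivation of C^oo(M) defined by [X]. *)
Definition vf_apply (X : vector_field) (f : Cinf M) : Cinf M :=
  mkCinf (vfP X f).

Fact lie_bracket_subproof (X Y : vector_field) (p : M) :
  (fun f => X p (vf_apply Y f) - Y p (vf_apply X f)) \in derivation_at p.
Proof.
have lin (Z : vector_field) (q : M) a f g :
    Z q (constC a * f + g) = a * Z q f + Z q g.
  by have /asboolP [+ _] := valP (Z q); apply.
have leib (Z : vector_field) (q : M) f g :
    Z q (f * g) = f q * Z q g + g q * Z q f.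
  by have /asboolP [_] := valP (Z q); apply.
have add (Z : vector_field) q f g : Z q (f + g) = Z q f + Z q g.
  have -> : f + g = constC 1 * f + g.
    by congr (_ + _); apply/val_inj/funext => r; rewrite /= mul1r.
  by rewrite lin mul1r.
have appl (Z : vector_field) a f g :
    vf_apply Z (constC a * f + g) = constC a * vf_apply Z f + vf_apply Z g.
  by apply/val_inj/funext => q; exact: lin.
have appM (Z : vector_field) f g :
    vf_apply Z (f * g) = f * vf_apply Z g + g * vf_apply Z f.
  by apply/val_inj/funext => q; exact: leib.
apply/asboolP; split=> [a f g|f g]; rewrite ?appl ?appM ?lin ?add ?leib /=.
  by ring.
by ring.
Qed.

Definition lie_bracket (X Y : vector_field) : vector_field :=
  @mkVectorField (fun p => MkTangent (lie_bracket_subproof X Y p))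
    (fun f => smooth_onB openT (vfP X (vf_apply Y f)) (vfP Y (vf_apply X f))).

Definition differential_at (f : Cinf M) (p : M) (v : tangent p) : R := v f.

Fact differential_at_linear f p : scalar (@differential_at f p).
Proof. by []. Qed.

HB.instance Definition _ f p := GRing.isLinear.Build R (tangent p) R *%R
  (@differential_at f p) (@differential_at_linear f p).

Definition differential (f : Cinf M) (p : M) : {scalar tangent p} :=
  @differential_at f p.

End VectorField.
Arguments vector_field {R n} M.

Section VectorBundle.
Variables (R : realType) (n : nat) (M : manifold R n).

(* Linear identifications over the open set [triv_base] of the fibres with
   R^[triv_rank]; [triv_map] and [triv_inv] are relevant only over
   [triv_base]. *)
Record trivialization (E : M -> lmodType R) := Trivialization {
  triv_base : set M ;
  triv_rank : nat ;
  triv_map : forall p, {linear E p -> 'rV[R]_triv_rank} ;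
  triv_inv : forall p, 'rV[R]_triv_rank -> E p ;
  triv_base_open : open triv_base ;
  triv_mapK : forall p, triv_base p -> cancel (triv_map p) (triv_inv p) ;
  triv_invK : forall p, triv_base p -> cancel (triv_inv p) (triv_map p) }.

Arguments triv_map {E} t p.
Arguments triv_inv {E} t p v.

(* A vector bundle given by its fibres and a family of local trivializations
   with smooth transition functions, which together determine the smooth
   structure of the total space. *)
Record vector_bundle := VectorBundle {
  fiber :> M -> lmodType R ;
  bundle_atlas : set (trivialization fiber) ;
  bundle_atlas_cover : forall p, exists2 t, bundle_atlas t & triv_base t p ;
  bundle_atlas_smooth : forall t s, bundle_atlas t -> bundle_atlas s ->
    forall (v : 'rV[R]_(triv_rank t)) (i : 'I_(triv_rank s)),
    smooth_on (triv_base t `&` triv_base s)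
      (fun p => triv_map s p (triv_inv t p v) 0 i) }.

Variable E : vector_bundle.

Definition smooth_section : {pred rough (fun p : M => fiber E p)} := fun a =>
  `[< forall t, bundle_atlas t -> forall i : 'I_(triv_rank t),
        smooth_on (triv_base t) (fun p => triv_map t p (a p) 0 i) >].

Fact smooth_section_zmod : zmod_closed smooth_section.
Proof.
split.
  apply/asboolP => t at_ i.
  have -> : (fun p => triv_map t p ((0 : rough (fun p : M => fiber E p)) p) 0 i)
    = (fun=> 0).
    by apply/funext => p; rewrite linear0 mxE.
  exact: smooth_on_cst.
move=> a b /asboolP sa /asboolP sb; apply/asboolP => t at_ i.
have -> : (fun p => triv_map t p ((a - b) p) 0 i)
    = (fun p => triv_map t p (a p) 0 i - triv_map t p (b p) 0 i).
  by apply/funext => p; rewrite [(a - b) p](_ : _ = a p - b p)// linearB !mxE.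
by apply: smooth_onB; [exact: triv_base_open|exact: sa|exact: sb].
Qed.

HB.instance Definition _ := GRing.isZmodClosed.Build
  (rough (fun p : M => fiber E p)) smooth_section smooth_section_zmod.

Record section := MkSection {
  section_val : rough (fun p : M => fiber E p) ;
  _ : section_val \in smooth_section }.

Definition section_at (a : section) (p : M) : fiber E p := section_val a p.
Coercion section_at : section >-> Funclass.

HB.instance Definition _ := [isSub for section_val].
HB.instance Definition _ := [Choice of section by <:].
HB.instance Definition _ := [SubChoice_isSubZmodule of section by <:].

Lemma sectionP (a : section) t : bundle_atlas t ->
  forall i : 'I_(triv_rank t),
  smooth_on (triv_base t) (fun p => triv_map t p (a p) 0 i).
Proof. by move=> bt i; case: a => a /= /asboolP /(_ t bt i). Qed.

Lemma section_ext (a b : section) : (forall p, a p = b p) -> a = b.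
Proof. by move=> ab; apply/val_inj/functional_extensionality_dep. Qed.

Fact scale_section_subproof (f : Cinf M) (a : section) :
  (fun p => f p *: a p) \in smooth_section.
Proof.
apply/asboolP => t at_ i.
have -> : (fun p => triv_map t p (f p *: a p) 0 i)
    = (fun p => f p * triv_map t p (a p) 0 i).
  by apply/funext => p; rewrite linearZ mxE.
apply: smooth_onM; [exact: triv_base_open| |exact: sectionP].
by apply: smooth_on_subset (CinfP f).
Qed.

Definition scale_section (f : Cinf M) (a : section) : section :=
  MkSection (scale_section_subproof f a).

Fact scale_sectionA f g a :
  scale_section f (scale_section g a) = scale_section (f * g) a.
Proof. by apply: section_ext => p; exact: scalerA. Qed.
Fact scale_section1 : left_id 1 scale_section.
Proof. by move=> a; apply: section_ext => p; exact: scale1r. Qed.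
Fact scale_sectionDr : right_distributive scale_section +%R.
Proof. by move=> f a b; apply: section_ext => p; exact: scalerDr. Qed.
Fact scale_sectionDl a : {morph scale_section^~ a : f g / f + g}.
Proof. by move=> f g; apply: section_ext => p; exact: scalerDl. Qed.

HB.instance Definition _ := GRing.Zmodule_isLmodule.Build (Cinf M) section
  scale_sectionA scale_section1 scale_sectionDr scale_sectionDl.

End VectorBundle.

Section Algebroid.
Variables (R : realType) (n : nat) (M : manifold R n).

(* Fibrewise structures are smooth when they map smooth sections to smooth
   functions (resp. smooth vector fields); on a Hausdorff second countable
   manifold this agrees with smoothness in local trivializations. *)
Record metric (E : vector_bundle M) := Metric {
  metric_val :> forall p : M, E p -> E p -> R ;
  metric_linear : forall p (a : E p), scalar (metric_val a) ;
  metric_sym : forall p (a b : E p), metric_val a b = metric_val b a ;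
  metric_nondegenerate : forall p (a : E p),
    (forall b : E p, metric_val a b = 0) -> a = 0 ;
  metric_smooth : forall a b : section E,
    smooth_on setT (fun p => metric_val (a p) (b p)) }.
Arguments metric_val {E} m p a b : rename.

Record anchor_map (E : vector_bundle M) := AnchorMap {
  anchor_val :> forall p : M, {linear E p -> tangent p} ;
  anchor_smooth : forall (a : section E) (f : Cinf M),
    smooth_on setT (fun p => anchor_val p (a p) f) }.

(* Sections form a module over C^oo(M); real scalars act through the constant
   functions [constC]. *)
Record algebroid_data := AlgebroidData {
  bundle :> vector_bundle M ;
  pairing : metric bundle ;
  anchor : anchor_map bundle ;
  bracket : section bundle -> section bundle -> section bundle ;
  bracket_linearl : forall (c : R) a a' b,
    bracket (constC c *: a + a') b = constC c *: bracket a b + bracket a' b ;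
  bracket_linearr : forall (c : R) a b b',
    bracket a (constC c *: b + b') = constC c *: bracket a b + bracket a b' }.

Variable A : algebroid_data.

Definition pair_sections (a b : section A) : Cinf M :=
  mkCinf (metric_smooth (pairing A) a b).

Definition rho (a : section A) : vector_field M :=
  @mkVectorField _ _ M (fun p => anchor A p (a p)) (anchor_smooth (anchor A) a).

(* [rho_star alpha] is the vector representing [alpha \o rho] with respect to
   the pairing; it exists since the fibres are finite-dimensional. *)
Definition rho_star (p : M) (alpha : {scalar tangent p}) : A p :=
  xget 0 [set e | forall b : A p, pairing A p e b = alpha (anchor A p b)].

Definition metric_algebroid : Prop :=
  (forall (a b : section A) (p : M),
     (bracket a b + bracket b a) p =
       rho_star (differential (pair_sections a b) p)) /\
  (forall a b c : section A,
     vf_apply (rho a) (pair_sections b c) =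
       pair_sections (bracket a b) c + pair_sections b (bracket a c)).

Definition curvature (a b : section A) : vector_field M :=
  rho (bracket a b) - lie_bracket (rho a) (rho b).

Definition curved_courant : Prop :=
  [/\ metric_algebroid,
      (forall (f : Cinf M) a a' b,
         curvature (f *: a + a') b = f *: curvature a b + curvature a' b),
      (forall (f : Cinf M) a b b',
         curvature a (f *: b + b') = f *: curvature a b + curvature a b'),
      (forall a b, curvature b a = - curvature a b) &
      (forall (a b : section A) (p : M), anchor A p (a p) = 0 ->
         curvature a b p = 0)].

Definition has_dim (V : lmodType R) (S : set V) (r : nat) : Prop :=
  exists b : 'I_r -> V,
    (forall c : 'I_r -> R, \sum_i c i *: b i = 0 -> forall i, c i = 0) /\
    S = [set \sum_i c i *: b i | c in [set: 'I_r -> R]].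

Definition regular_algebroid : Prop :=
  exists r : nat, forall p, has_dim (range (anchor A p)) r.

Definition transitive_algebroid : Prop := forall p, range (anchor A p) = setT.

End Algebroid.

Section TangentValuedForms.
Variables (R : realType) (n : nat) (M : manifold R n).

(* Elements of Omega^2(M, TM). *)
Record tangent_form2 := TangentForm2 {
  form2_val :> forall p : M, tangent p -> tangent p -> tangent p ;
  form2_linearl : forall p (v : tangent p), linear ((@form2_val p)^~ v) ;
  form2_linearr : forall p (u : tangent p), linear (@form2_val p u) ;
  form2_alternating : forall p (u : tangent p), @form2_val p u u = 0 ;
  form2_smooth : forall (X Y : vector_field M) (f : Cinf M),
    smooth_on setT (fun p => @form2_val p (X p) (Y p) f) }.
Arguments form2_val t p u v : rename.

Definition form2_apply (T : tangent_form2) (X Y : vector_field M) :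
    vector_field M :=
  @mkVectorField _ _ M (fun p => T p (X p) (Y p)) (form2_smooth T X Y).

End TangentValuedForms.

(* Main.v *)
From HB Require Import structures.
Require Import Defs.
From mathcomp Require Import all_boot all_order all_algebra.
From mathcomp Require Import all_classical all_reals all_analysis.
From mathcomp Require Import ring.
Set Implicit Arguments.
Unset Strict Implicit.
Unset Printing Implicit Defensive.
Import Order.TTheory GRing.Theory Num.Theory.
Import numFieldNormedType.Exports.
Local Open Scope classical_set_scope.
Local Open Scope ring_scope.

(** Writing F for the curvature, the equivalence is a matter of extending F,
    which lives on the image of the anchor rho, to the whole tangent bundle.

    If F = T(rho, rho) for a two-form T, then bilinearity, skew-symmetry and
    the vanishing on ker rho are inherited from T.

    Conversely, let F be tensorial and vanish on ker rho.  A linear relation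
    at p between vectors rho(a_i)_p then gives the same relation between the
    values F(a_i, b)_p, since the combination of the a_i is killed by rho at p
    ([curvature_tensorial]).  So F induces a form on the image of rho, and an
    extension to TM is needed, smooth although the image is only known to have
    constant rank r.  Choose sections a_1, ..., a_r and functions f_1, ..., f_r,
    and set G_ij = rho(a_i)(f_j), g = det G.  By Cramer's rule the functionals
    theta_i(u) = g * sum_j u(f_j) adj(G)_ji satisfy
    sum_i theta_i(v) rho(a_i) = g^2 v for every v in the image of rho, at every
    point: where g <> 0 the rho(a_i) form a basis of the image, and where g = 0
    both sides vanish.  Hence S(u, v) = sum_il theta_i(u) theta_l(v) F(a_i, a_l)
    is a globally smooth form with S(rho a, rho b) = g^4 F(a, b)
    ([frame_tangent_formE]).  Every point has such data with g <> 0 there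
    ([frame_at]): a basis of the image at p lifts to global sections by means
    of bump functions ([section_through]), and the f_j exist because linearly
    independent derivations are in particular independent functions on
    C^oo(M) ([independent_dual]).

    As M is second countable, countably many data (S_k, w_k = g_k^4) and
    constants l_k suffice for the sets { l_k w_k > 1 } to cover M.  Let
    c_k = prod_(j < k) phi(1 - l_j w_j), where phi(t) = exp(-1/t) for t > 0 and
    phi(t) = 0 for t <= 0.  On { l_m w_m > 1 } all c_k with k > m vanish, so the
    sums N = sum_k c_k S_k and D = sum_k c_k w_k are locally finite.  Moreover
    D > 0, because of the first k with w_k <> 0.  As N(rho a, rho b) = D F(a, b),
    the quotient T = N / D is the required form ([glued_formE]).

    If rho is surjective, every pair of tangent vectors has the form
    (rho(a)_p, rho(b)_p) for global sections a and b, so T is determined by F. *)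

(** * A smooth function vanishing on a half-line *)

Section Flat.
Variable R : realType.

(** The family t^-m exp(-1/t), extended by 0, rather than its member m = 0
    alone, because the family is closed under differentiation. *)
Definition flat (m : nat) (t : R) : R :=
  if 0 < t then t^-1 ^+ m * expR (- t^-1) else 0.

Lemma flat_ge0 m t : 0 <= flat m t.
Proof.
rewrite /flat; case: ifP => // t0.
by rewrite mulr_ge0 ?expR_ge0// exprn_ge0// invr_ge0 ltW.
Qed.

Lemma flat0_gt0 t : 0 < t -> 0 < flat 0 t.
Proof. by rewrite /flat => ->; rewrite expr0 mul1r expR_gt0. Qed.

Lemma flat_eq0 m t : t <= 0 -> flat m t = 0.
Proof. by rewrite /flat leNgt => /negbTE ->. Qed.

(** The quadratic bound makes the difference quotient at 0 tend to 0; it is the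
    inequality s^(m+2) / (m+2)! <= exp s at s = 1/t. *)
Lemma flat_le_sqr m t : flat m t <= (m.+2)`!%:R * t ^+ 2.
Proof.
rewrite /flat; case: ifPn => [t0|_]; last by rewrite mulr_ge0 ?sqr_ge0.
have s0 : 0 < t^-1 by rewrite invr_gt0.
have := @expR_ge1Dxn R t^-1 m.+1 (ltW s0).
set c : R := (m.+2)`!%:R => H.
have c0 : 0 < c by rewrite ltr0n fact_gt0.
have {}H : t^-1 ^+ m.+2 <= c * expR t^-1.
  rewrite mulrC -ler_pdivrMr//; apply: le_trans H.
  by rewrite lerDr.
rewrite expRN ler_pdivrMr ?expR_gt0//.
have : t^-1 ^+ m.+2 * t ^+ 2 <= c * expR t^-1 * t ^+ 2.
  by rewrite ler_wpM2r// sqr_ge0.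
rewrite -addn2 exprD -mulrA -exprMn mulVf ?gt_eqF// expr1n mulr1.
by rewrite mulrAC.
Qed.

Lemma is_derive_flat m (t : R) :
  is_derive t (1 : R) (flat m) (flat m.+2 t - m%:R * flat m.+1 t).
Proof.
have [t0|t0|<-] := ltgtP 0 t.
- have n0 : t != 0 by rewrite gt_eqF.
  apply: (@near_eq_is_derive R R R (fun t => t^-1 ^+ m * expR (- t^-1))).
    near=> s; rewrite /flat ifT//; near: s; exact: lt_nbhsr.
  have d1 : is_derive t (1 : R) (fun t : R => t^-1) (- t ^- 2).
    have := @is_deriveV R id t 1 1 n0 (is_derive_id _ _).
    by rewrite /GRing.scale /= mulr1.
  have d2 : is_derive t (1 : R) (fun t : R => expR (- t^-1))
      (expR (- t^-1) * t ^- 2).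
    apply: (@is_derive1_comp R expR (fun t => - t^-1)).
    by rewrite -[t ^- 2]opprK; exact: is_deriveN.
  have d3 : is_derive t (1 : R) (fun t : R => t^-1 ^+ m)
      (- (t ^- 2 * m%:R * t^-1 ^+ m.-1)).
    have := @is_deriveX R R (fun t : R => t^-1) m t 1 _ d1.
    have -> : (fun t : R => t^-1) ^+ m = (fun t : R => t^-1 ^+ m).
      by apply/funext => s; elim: (m) => // k IH; rewrite !exprS -IH.
    by move/is_derive_eq; apply; rewrite /GRing.scale /=; ring.
  apply: (is_derive_eq (is_deriveM d3 d2)).
  rewrite /flat t0 /GRing.scale /=.
  case: (m) => [|k]; first by rewrite /= !mul0r; field.
  rewrite /= -!exprVn !exprS expr0; ring.
- apply: (@near_eq_is_derive R R R (cst 0)).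
    near=> s; rewrite flat_eq0// ltW//; near: s; exact: lt_nbhsl.
  by rewrite !flat_eq0 ?ltW// mulr0 subr0; exact: is_derive_cst.
- rewrite !flat_eq0// mulr0 subr0.
  suff H : h^-1 *: (flat m (h *: (1 : R) + 0) - flat m 0) @[h --> 0^'] -->
      (0 : R).
    by split; [apply/cvg_ex; exists 0|exact: cvg_lim].
  set c : R := (m.+2)`!%:R.
  have c0 : 0 <= c by rewrite ler0n.
  have cn : c * `|h| @[h --> (0 : R)^'] --> c * `|0 : R|.
    apply: cvg_within_filter; apply: cvgMl_tmp; exact: norm_continuous.
  apply: (@squeeze_cvgr _ _ _ _ (fun h : R => - (c * `|h|))
    (fun h : R => c * `|h|)).
  + near=> h.
    have h0 : h != 0 by near: h; exact: nbhs_dnbhs_neq.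
    rewrite -ler_norml (flat_eq0 m (lexx 0)) subr0 addr0 [h *: 1]mulr1.
    rewrite normrM normfV ger0_norm ?flat_ge0// mulrC ler_pdivrMr ?normr_gt0//.
    by rewrite -mulrA -expr2 real_normK ?num_real// flat_le_sqr.
  + have := cvgN cn; rewrite normr0 mulr0 oppr0; exact.
  + by have := cn; rewrite normr0 mulr0.
Unshelve. all: by end_near. Qed.
End Flat.

(** * Composition and locality of smooth functions *)

Section CkComposition.
Variables (R : realType) (n : nat).
Implicit Types (U V : set 'rV[R]_n) (f g : 'rV[R]_n -> R).

(** Directional derivatives are ordinary derivatives along lines, which reduces
    this chain rule to the one-variable one, although [g] is only known to have
    a derivative in the direction [v]. *)
Lemma is_derive_comp (h : R -> R) g (x v : 'rV[R]_n) (a : R) :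
  is_derive (g x) (1 : R) h a -> derivable g x v ->
  is_derive x v (fun y => h (g y)) (a * 'D_v g x).
Proof.
move=> dh dg.
have line (k : 'rV[R]_n -> R) (b : R) :
    is_derive x v k b <-> is_derive (0 : R) (1 : R) (fun s => k (s *: v + x)) b.
  have E : (fun s : R => s^-1 *: (k (s *: v + x) - k x)) =
      (fun s : R => s^-1 *: (k ((s *: (1 : R) + 0) *: v + x) - k (0 *: v + x))).
    by apply/funext => s /=; rewrite addr0 scale0r add0r [_%:A]mulr1.
  split=> -[d1 d2]; split.
  - exact: (derivable1P k x v).1.
  - by move: d2; rewrite /derive /= E.
  - exact: (derivable1P k x v).2.
  - by rewrite /derive /= E.
apply/line.
have dg' : is_derive (0 : R) (1 : R) (fun s => g (s *: v + x)) ('D_v g x).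
  by apply/line; exact: derivableP.
apply: (@is_derive1_comp _ h (fun s => g (s *: v + x))).
by rewrite scale0r add0r.
Qed.

Lemma Ck_local k U f :
  (forall x, U x -> exists V, [/\ open V, V x & Ck k V f]) -> Ck k U f.
Proof.
elim: k f => [|k IH] f H; split=> //.
- by move=> x /H[V [_ Vx [+ _]]]; apply.
- by move=> x /H[V [_ Vx [+ _]]]; apply.
move=> v; split=> [x /H[V [_ Vx [_ /(_ v)[+ _]]]]|]; first by apply.
apply: IH => x /H[V [oV Vx [_ /(_ v)[_ df]]]]; by exists V.
Qed.

(** The induction on [k] runs over all members of the family at once. *)
Lemma Ck_flat k U g m : open U -> Ck k U g -> Ck k U (fun x => flat m (g x)).
Proof.
move=> oU; elim: k m g => [|k IH] m g Cg.
all: have cg := Ck_continuous Cg.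
all: have cfg x : U x -> {for x, continuous (fun x => flat m (g x))}.
1,3: move=> Ux; apply: (@continuous_comp _ _ _ g (flat m)); first exact: cg.
1,2: apply: differentiable_continuous; apply/derivable1_diffP.
1,2: exact: (@ex_derive _ _ _ _ _ _ _ (is_derive_flat m (g x))).
  by split.
split=> // v; have [_ /(_ v)[dg Cdg]] := Cg.
have d x Ux := is_derive_comp (is_derive_flat m (g x)) (dg x Ux).
split=> [x Ux|]; first exact: (@ex_derive _ _ _ _ _ _ _ (d x Ux)).
have Cg' := CkS Cg.
apply: eq_Ck oU _ (CkM oU (CkD oU (IH m.+2 _ Cg')
  (CkM oU (@Ck_cst R n k U (- m%:R)) (IH m.+1 _ Cg'))) Cdg) => x Ux.
by rewrite (@derive_val _ _ _ _ _ _ _ (d x Ux)) mulNr.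
Qed.

Lemma Ck_inv k U g : open U -> (forall x, U x -> g x != 0) ->
  Ck k U g -> Ck k U (fun x => (g x)^-1).
Proof.
move=> oU g0; elim: k g g0 => [|k IH] g g0 Cg.
all: have cg := Ck_continuous Cg.
all: have cVg x : U x -> {for x, continuous (fun x => (g x)^-1)}
  by move=> Ux; apply: continuousV; [exact: g0|exact: cg].
  by split.
split=> // v; have [_ /(_ v)[dg Cdg]] := Cg.
split=> [x Ux|]; first by apply: derivableV; [exact: g0|exact: dg].
have CV := IH _ g0 (CkS Cg).
apply: eq_Ck oU _ (CkM oU (@Ck_cst R n k U (-1)) (CkM oU (CkM oU CV CV) Cdg)).
move=> x Ux; rewrite deriveV; [|exact: g0|exact: dg].
by rewrite -exprVn expr2 mulN1r -mulNr.
Qed.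

End CkComposition.

Section SmoothOn.
Variables (R : realType) (n : nat) (M : manifold R n).
Implicit Types (U V : set M) (f g : M -> R).

Lemma smooth_on_local U f :
  (forall p, U p -> exists V, [/\ open V, V p & smooth_on V f]) ->
  smooth_on U f.
Proof.
move=> H c ac k; apply: Ck_local => x [cx /H[V [oV Vx sV]]].
by exists (chart_image c V); split=> //; [exact: chart_image_open|exact: sV].
Qed.

Lemma eq_smooth_on U f g : open U -> (forall p, U p -> f p = g p) ->
  smooth_on U f -> smooth_on U g.
Proof.
move=> oU fg sf c ac k; apply: eq_Ck (sf c ac k); first exact: chart_image_open.
by move=> x [_ /fg].
Qed.

Lemma smooth_on_flat U f m : open U -> smooth_on U f ->
  smooth_on U (fun p => flat m (f p)).
Proof.
by move=> oU sf c ac k; apply: Ck_flat (sf c ac k); exact: chart_image_open.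
Qed.

Lemma smooth_on_inv U f : open U -> (forall p, U p -> f p != 0) ->
  smooth_on U f -> smooth_on U (fun p => (f p)^-1).
Proof.
move=> oU f0 sf c ac k; apply: Ck_inv (sf c ac k).
  exact: chart_image_open.
by move=> x [_ /f0].
Qed.

Lemma smooth_on_sum U (I : Type) (s : seq I) (f : I -> M -> R) : open U ->
  (forall i, smooth_on U (f i)) -> smooth_on U (fun p => \sum_(i <- s) f i p).
Proof.
move=> oU sf; elim: s => [|i s IH].
  by under eq_fun do rewrite big_nil; exact: smooth_on_cst.
by under eq_fun do rewrite big_cons; exact: (smooth_onD oU (sf i) IH).
Qed.

Lemma CinfME (f g : Cinf M) p : (f * g) p = f p * g p.
Proof. by []. Qed.

Lemma Cinf_continuous (f : Cinf M) : continuous (f : M -> R).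
Proof.
move=> p; have [c ac dp] := manifold_atlas_cover p.
have near_dom : \forall q \near p, chart_dom c q.
  by apply: open_nbhs_nbhs; split=> //; exact: chart_dom_open.
have e : \forall q \near p, f (chart_inv c (chart_map c q)) = f q.
  by apply: filterS near_dom => q dq; rewrite chart_mapK.
rewrite /continuous_at -[in X in _ --> X](chart_mapK dp).
apply: cvg_trans (near_eq_cvg e) _.
apply: (@continuous_comp _ _ _ (chart_map c) (fun x => f (chart_inv c x))).
  exact: chart_map_continuous.
apply: (Ck_continuous (CinfP f ac 0%N)).
by split=> //; exact: chart_mapP.
Qed.

Lemma Cinf_gt_open (f : Cinf M) (y : R) : open [set p | y < f p].
Proof.
apply: (@open_comp _ _ f [set z | y < z]); last exact: open_gt.
by move=> p _; exact: Cinf_continuous.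
Qed.

End SmoothOn.

(** * Bump functions and sections through a point *)

Section Bump.
Variables (R : realType) (n : nat) (M : manifold R n).

(** In a chart the bump is flat(e^2 - |x - x0|^2).  It vanishes off a compact
    box, whose image in M is closed because M is Hausdorff; this is what makes
    the extension by 0 smooth.  [O] is the complement of that image. *)
Lemma bump_function (p0 : M) (U : set M) : open U -> U p0 ->
  exists (chi : Cinf M) (O : set M),
    [/\ open O, forall p, O p \/ U p, forall p, O p -> chi p = 0 & chi p0 = 1].
Proof.
move=> oU Up0; have [d ad dp0] := manifold_atlas_cover p0.
pose x0 := chart_map d p0.
have d_x0 : chart_codom d x0 by exact: chart_mapP.
have /nbhs_ballP[e e0 ball_sub] : nbhs x0 (chart_image d U).
  apply: open_nbhs_nbhs; split; first exact: chart_image_open.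
  by split=> //; rewrite chart_mapK.
pose e' := e / 2.
have e'0 : 0 < e' by rewrite divr_gt0.
pose box : set 'rV[R]_n :=
  [set x | forall i, `[x0 0 i - e', x0 0 i + e']%classic (x ord0 i)].
have box_sub : box `<=` chart_image d U.
  move=> x bx; apply: ball_sub; rewrite -ball_normE /ball_ /=.
  apply: le_lt_trans (_ : e' < e).
    2: by rewrite ltr_pdivrMr// mulr2n mulrDr mulr1 ltrDl.
  rewrite [X in X <= _]mx_normrE; apply: bigmax_le; first exact: ltW.
  case=> i j _; rewrite !mxE /= (ord1 i) distrC ler_distl.
  by have := bx j; rewrite /= in_itv /=.
pose K := chart_inv d @` box.
have cK : closed K.
  apply: compact_closed; first exact: manifold_hausdorff.
  apply: continuous_compact.
    apply: continuous_in_subspaceT => x /set_mem /box_sub[dx _].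
    exact: chart_inv_continuous.
  apply: (@rV_compact _ _ (fun i => `[x0 0 i - e', x0 0 i + e']%classic)) => i.
  exact: segment_compact.
have K_dom p : K p -> chart_dom d p /\ U p.
  move=> [x /box_sub[dx Ux] <-]; split=> //; exact: chart_invP.
pose beta (x : 'rV[R]_n) : R := flat 0 (e' ^+ 2 - \sum_i (x 0 i - x0 0 i) ^+ 2).
have beta0 x : ~ box x -> beta x = 0.
  move=> /existsNP[i bi]; apply: flat_eq0; rewrite subr_le0.
  apply: (@le_trans _ _ ((x 0 i - x0 0 i) ^+ 2)).
    rewrite -[leRHS]real_normK ?num_real//.
    rewrite lerXn2r ?nnegrE ?normr_ge0 ?(ltW e'0)//.
    rewrite leNgt; apply/negP => /ltW H; apply: bi.
    by rewrite /= in_itv /= -ler_distl.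
  by rewrite (bigD1 i)//= lerDl sumr_ge0// => j _; exact: sqr_ge0.
pose chi0 (p : M) : R :=
  if `[< chart_dom d p >] then beta (chart_map d p) else 0.
have chi0K p : ~ K p -> chi0 p = 0.
  move=> Kp; rewrite /chi0; case: asboolP => // dp; apply: beta0 => bp.
  by apply: Kp; exists (chart_map d p) => //; exact: chart_mapK.
have sm : smooth_on setT chi0.
  apply: smooth_on_local => p _; have [Kp|Kp] := pselect (K p).
    have [dp _] := K_dom p Kp; exists (chart_dom d); split=> //.
      exact: chart_dom_open.
    apply: (@eq_smooth_on _ _ _ _ (fun p => beta (chart_map d p))).
    - exact: chart_dom_open.
    - by move=> q dq; rewrite /chi0; case: asboolP.
    apply: (@smooth_on_flat _ _ _ _
      (fun q => e' ^+ 2 - \sum_i (chart_map d q 0 i - x0 0 i) ^+ 2)).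
      exact: chart_dom_open.
    apply: smooth_onB; [exact: chart_dom_open|exact: smooth_on_cst|].
    apply: smooth_on_sum => [|i]; first exact: chart_dom_open.
    under eq_fun do rewrite expr2.
    have s1 : smooth_on (chart_dom d) (fun q => chart_map d q 0 i - x0 0 i).
      apply: smooth_onB; [exact: chart_dom_open| |exact: smooth_on_cst].
      by move=> c ac; exact: manifold_atlas_smooth.
    exact: (smooth_onM (@chart_dom_open _ _ _ d) s1 s1).
  exists (~` K); split=> //; first exact: closed_openC.
  apply: (@eq_smooth_on _ _ _ _ (fun=> 0)); first exact: closed_openC.
    by move=> q /chi0K.
  exact: smooth_on_cst.
have chi0p0 : 0 < chi0 p0.
  rewrite /chi0; case: asboolP => // _; apply: flat0_gt0.
  rewrite big1 ?subr0 ?exprn_gt0// => i _.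
  by rewrite subrr expr0n.
exists (constC (chi0 p0)^-1 * mkCinf sm), (~` K); split.
- exact: closed_openC.
- by move=> p; have [/K_dom[_ ?]|] := pselect (K p); [right|left].
- by move=> p /chi0K cp; rewrite CinfME [mkCinf sm p]cp mulr0.
- by rewrite CinfME [LHS]mulVf// gt_eqF.
Qed.

(** Extend the vector by a constant in a trivialization and multiply by a bump
    function supported in its base. *)
Lemma section_through (E : vector_bundle M) (p0 : M) (e : E p0) :
  exists a : section E, a p0 = e.
Proof.
have [t bt tp0] := bundle_atlas_cover E p0.
have [chi [W [oW WU chi0 chi1]]] :=
  bump_function (@triv_base_open _ _ _ _ t) tp0.
pose v := triv_map t p0 e.
pose a (p : M) : E p :=
  if `[< triv_base t p >] then chi p *: @triv_inv _ _ _ _ t p v else 0.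
have aW p : W p -> a p = 0.
  by move=> /chi0 ap; rewrite /a ap scale0r; case: ifP.
have sa : (a : rough (fun p : M => E p)) \in @smooth_section _ _ _ E.
  apply/asboolP => s bs i; apply: smooth_on_local => p sp.
  have [Wp|tp] := WU p.
    exists W; split=> //; apply: (@eq_smooth_on _ _ _ _ (fun=> 0)) => //.
      by move=> q /aW ->; rewrite linear0 mxE.
    exact: smooth_on_cst.
  have ot := @triv_base_open _ _ _ _ t.
  have os := @triv_base_open _ _ _ _ s.
  exists (triv_base t `&` triv_base s); split=> //; first exact: openI.
  apply: (@eq_smooth_on _ _ _ _
    (fun q => chi q * triv_map s q (@triv_inv _ _ _ _ t q v) 0 i)).
    exact: openI.
    move=> q [tq _]; rewrite /a; case: asboolP => // _.
    by rewrite linearZ mxE.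
  apply: smooth_onM; [exact: openI| |exact: bundle_atlas_smooth].
  by apply: smooth_on_subset (CinfP chi).
exists (MkSection sa); rewrite /section_at /= /a; case: asboolP => // _.
by rewrite chi1 scale1r triv_mapK.
Qed.

End Bump.

(** * Linear algebra of frames *)

Section LinearAlgebra.

(** The points are chosen one at a time: while there are fewer than r of them,
    some nonzero combination of the [b i] vanishes at all of them, and a point
    where it does not vanish raises the rank. *)
Lemma independent_dual (K : fieldType) (X : Type) (r : nat)
    (b : 'I_r -> X -> K) :
  (forall c : 'I_r -> K, (forall x, \sum_i c i * b i x = 0) ->
     forall i, c i = 0) ->
  exists f : 'I_r -> X, \det (\matrix_(i, j) b i (f j)) != 0.
Proof.
move=> indep.
suff [f Ff] : exists f : 'I_r -> X, row_free (\matrix_(j, i) b i (f j)).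
  exists f; rewrite -det_tr -unitfE -unitmxE -row_free_unit.
  by congr row_free: Ff; apply/matrixP => i j; rewrite !mxE.
suff H k : (k <= r)%N ->
    exists f : 'I_k -> X, row_free (\matrix_(j < k, i < r) b i (f j)).
  exact: H.
elim: k => [_|k IH kr].
  have f0 : 'I_0 -> X by case.
  by exists f0; rewrite /row_free [\matrix_(_, _) _]flatmx0 mxrank0.
have [f Ff] := IH (ltnW kr); rewrite -addn1.
set A := (\matrix_(j, i) _) in Ff.
have [c Ac c0] : exists2 c : 'cV[K]_r, A *m c = 0 & c != 0.
  have : cokermx A != 0.
    by rewrite -mxrank_eq0 mxrank_coker (eqP Ff) -lt0n subn_gt0.
  move=> /eqP/matrixP C0.
  have [j /eqP Cj] : exists j, col j (cokermx A) != 0.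
    apply: contrapT => /forallNP H; apply: C0 => i j.
    by have /negP := H j; rewrite negbK => /eqP/colP/(_ i); rewrite !mxE.
  exists (col j (cokermx A)); last exact/eqP.
  by rewrite colE mulmxA mulmx_coker mul0mx.
have [x xc] : exists x, \sum_i c i 0 * b i x != 0.
  apply: contrapT => /forallNP H; move/eqP: c0; apply.
  apply/colP => i; rewrite mxE; apply: (indep (fun i => c i 0)) => x.
  by have /negP := H x; rewrite negbK => /eqP.
pose f' (j : 'I_(k + 1)) :=
  match fintype.split j with inl j => f j | inr _ => x end.
exists f'.
have -> : (\matrix_(j < k + 1, i < r) b i (f' j)) =
    col_mx A (\row_i b i x).
  apply/matrixP => j i; rewrite !mxE /f'.
  by case: (fintype.split j) => j'; rewrite mxE.
apply: inj_row_free => v; rewrite -[v]hsubmxK mul_row_col => v0.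
have vc : rsubmx v 0 0 * (\sum_i c i 0 * b i x) = 0.
  set s := (X in _ * X); have /matrixP/(_ 0 0) :
      (lsubmx v *m A + rsubmx v *m (\row_i b i x)) *m c = 0.
    by rewrite v0 mul0mx.
  rewrite mulmxDl -!mulmxA Ac mulmx0 add0r mxE big_ord1 [RHS]mxE => <-.
  by congr (_ * _); rewrite /s mxE; apply: eq_bigr => i _; rewrite mxE mulrC.
have r0 : rsubmx v = 0.
  apply/rowP => j; rewrite [RHS]mxE (ord1 j).
  by apply/eqP; move/eqP: vc; rewrite mulf_eq0 (negbTE xc) orbF !mxE.
have l0 : lsubmx v = 0.
  by apply: (row_free_inj Ff); rewrite mul0mx -v0 r0 mul0mx addr0.
by rewrite l0 r0 row_mx0.
Qed.

(** If [\det G] is nonzero then the [u i] form a basis of [S], and this is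
    Cramer's rule for the coordinates of [v], multiplied by [\det G].  The extra
    factor [\det G] makes both sides vanish when [\det G = 0], so that the
    identity holds without any condition on [G]. *)
Lemma cramer_span (R : realType) (V : lmodType R) (S : set V) (r : nat)
    (phi : 'I_r -> {scalar V}) (u : 'I_r -> V) (v : V) (G : 'M[R]_r) :
  has_dim S r -> (forall i, S (u i)) -> S v ->
  (forall i j, G i j = phi j (u i)) ->
  \sum_i (\det G * \sum_j phi j v * \adj G j i) *: u i = (\det G) ^+ 2 *: v.
Proof.
move=> [b [_ Sb]] Su Sv Gphi.
have [g0|gn0] := eqVneq (\det G) 0.
  by rewrite g0 expr0n scale0r big1// => i _; rewrite mul0r scale0r.
move: Sv; rewrite Sb => -[c _ cv].
have {}Su i : exists P : 'I_r -> R, \sum_s P s *: b s = u i.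
  by have := Su i; rewrite Sb => -[P _ Pu]; exists P.
pose P : 'M[R]_r := \matrix_(i, s) projT1 (cid (Su i)) s.
have uE i : u i = \sum_s P i s *: b s.
  by rewrite -(projT2 (cid (Su i))); apply: eq_bigr => s _; rewrite mxE.
pose Q : 'M[R]_r := \matrix_(s, j) phi j (b s).
have GE : G = P *m Q.
  apply/matrixP => i j; rewrite Gphi uE linear_sum mxE; apply: eq_bigr => s _.
  by rewrite linearZ !mxE.
have Pu : P \in unitmx.
  rewrite unitmxE unitfE; apply: contra_neq gn0 => P0.
  by rewrite GE det_mulmx P0 mul0r.
pose d : 'rV[R]_r := \row_s c s *m invmx P.
have vE : v = \sum_i d 0 i *: u i.
  have dP : d *m P = \row_s c s by rewrite /d mulmxKV.
  rewrite -cv; under [RHS]eq_bigr do rewrite uE scaler_sumr.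
  rewrite exchange_big /=; apply: eq_bigr => s _.
  under eq_bigr do rewrite scalerA; rewrite -scaler_suml; congr (_ *: _).
  by have /rowP/(_ s) := dP; rewrite !mxE => ->.
have wE i : \sum_j phi j v * \adj G j i = \det G * d 0 i.
  have /rowP/(_ i) : (d *m G) *m \adj G = \det G *: d.
    by rewrite -mulmxA mul_mx_adj mul_mx_scalar.
  rewrite [RHS]mxE => <-; rewrite [RHS]mxE.
  apply: eq_bigr => j _; congr (_ * _).
  rewrite vE linear_sum mxE; apply: eq_bigr => s _.
  by rewrite linearZ /= Gphi.
rewrite [in RHS]vE scaler_sumr; apply: eq_bigr => i _.
by rewrite wE mulrA -expr2 scalerA.
Qed.

End LinearAlgebra.

(** * Tensoriality of the curvature and frames of the image of the anchor *)

Section Evaluation.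
Variables (R : realType) (n : nat) (M : manifold R n).

(** Evaluation as a named function, so that it can be given the structure of a
    ring morphism and commutes with determinants and adjugates. *)
Definition evalC (p : M) (f : Cinf M) : R := f p.

Fact evalC_additive p : zmod_morphism (evalC p).
Proof. by []. Qed.

Fact evalC_monoid p : monoid_morphism (evalC p).
Proof. by []. Qed.

HB.instance Definition _ p :=
  GRing.isZmodMorphism.Build (Cinf M) R (evalC p) (evalC_additive p).
HB.instance Definition _ p :=
  GRing.isMonoidMorphism.Build (Cinf M) R (evalC p) (evalC_monoid p).

Lemma tangent_sumE p (I : Type) (s : seq I) (F : I -> tangent p) (f : Cinf M) :
  (\sum_(i <- s) F i) f = \sum_(i <- s) F i f.
Proof. exact: (big_morph (fun v : tangent p => v f) (fun u v => erefl) erefl). Qed.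

Lemma vf_sumE p (I : Type) (s : seq I) (F : I -> vector_field M) :
  (\sum_(i <- s) F i) p = \sum_(i <- s) F i p.
Proof.
exact: (big_morph (fun X : vector_field M => X p) (fun u v => erefl) erefl).
Qed.

Lemma section_sumE (E : vector_bundle M) p (I : Type) (s : seq I)
    (F : I -> section E) : (\sum_(i <- s) F i) p = \sum_(i <- s) F i p.
Proof.
exact: (big_morph (fun X : section E => X p) (fun u v => erefl) erefl).
Qed.

End Evaluation.

#[local] Arguments curvature : simpl never.

Section Tensoriality.
Variables (R : realType) (n : nat) (M : manifold R n) (A : algebroid_data M).
Hypothesis hC : curved_courant A.

Lemma curvature_suml (I : Type) (s : seq I) (f : I -> Cinf M)
    (a : I -> section A) b :
  curvature (\sum_(i <- s) f i *: a i) b = \sum_(i <- s) f i *: curvature (a i) b.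
Proof.
case: hC => _ hl _ _ _; elim: s => [|i s IH].
  rewrite !big_nil; have := hl 1 0 0 b.
  by rewrite !scale1r addr0 -[LHS]addr0 => /addrI.
by rewrite !big_cons hl IH.
Qed.

(** The difference of the two combinations of sections is annihilated by the
    anchor at [p], hence by the curvature. *)
Lemma curvature_tensorial (I : Type) (s : seq I) (c : I -> R)
    (a : I -> section A) (c0 : R) (a0 b : section A) p :
  \sum_(i <- s) c i *: rho (a i) p = c0 *: rho a0 p ->
  \sum_(i <- s) c i *: curvature (a i) b p = c0 *: curvature a0 b p.
Proof.
move=> H; case: (hC) => _ hl _ _ hk.
pose x : section A := constC (- c0) *: a0 + \sum_(i <- s) constC (c i) *: a i.
have x0 : anchor A p (x p) = 0.
  have -> : x p = - c0 *: a0 p + (\sum_(i <- s) constC (c i) *: a i) p by [].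
  rewrite section_sumE linearD linearZ linear_sum /= scaleNr.
  apply/eqP; rewrite addrC subr_eq0 -[X in _ == X]H; apply/eqP.
  by apply: eq_bigr => i _; rewrite -linearZ.
have := hk x b p x0; rewrite hl curvature_suml.
have -> : (constC (- c0) *: curvature a0 b +
    \sum_(i <- s) constC (c i) *: curvature (a i) b) p =
  - c0 *: curvature a0 b p + (\sum_(i <- s) constC (c i) *: curvature (a i) b) p.
  by [].
by rewrite vf_sumE scaleNr addrC => /eqP; rewrite subr_eq0 => /eqP <-.
Qed.

Lemma curvature_skew (a b : section A) p : curvature b a p = - curvature a b p.
Proof. by case: hC => _ _ _ hs _; rewrite hs. Qed.

End Tensoriality.

Section LocalForm.
Variables (R : realType) (n : nat) (M : manifold R n) (A : algebroid_data M).
Hypothesis hC : curved_courant A.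
Variable r : nat.
Hypothesis hr : forall p, has_dim (range (anchor A p)) r.
Variables (a : 'I_r -> section A) (f : 'I_r -> Cinf M).

Definition pairing_matrix : 'M[Cinf M]_r :=
  \matrix_(i, j) vf_apply (rho (a i)) (f j).
Let G := pairing_matrix.

(** Up to the factor [(\det G) ^+ 2], the coordinates with respect to the frame
    [rho (a i)] on the image of the anchor, extended to all tangent vectors by
    means of the functions [f j]. *)
Definition coframe (i : 'I_r) (p : M) (u : tangent p) : R :=
  (\det G) p * \sum_j u (f j) * (\adj G j i) p.

Definition frame_form (p : M) (u v : tangent p) : tangent p :=
  \sum_i coframe i u *: \sum_l coframe l v *: curvature (a i) (a l) p.

Lemma coframe_linear i p : scalar (@coframe i p).
Proof.
move=> c u v; rewrite /coframe mulrCA -mulrDr; congr (_ * _).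
rewrite mulr_sumr -big_split; apply: eq_bigr => j _.
by rewrite tangentDE tangentZE mulrDl mulrA.
Qed.

Lemma frame_form_linearl p (v : tangent p) : linear ((@frame_form p)^~ v).
Proof.
move=> c u u'; rewrite /frame_form scaler_sumr -big_split; apply: eq_bigr => i _.
by rewrite coframe_linear scalerDl scalerA.
Qed.

Lemma frame_form_linearr p (u : tangent p) : linear (@frame_form p u).
Proof.
move=> c v v'; rewrite /frame_form scaler_sumr -big_split /=.
apply: eq_bigr => i _.
rewrite [in RHS]scalerA [c * _]mulrC -[in RHS]scalerA -scalerDr.
congr (_ *: _); rewrite scaler_sumr -big_split; apply: eq_bigr => l _.
by rewrite coframe_linear scalerDl scalerA.
Qed.

Lemma frame_form_alternating p (u : tangent p) : frame_form u u = 0.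
Proof.
suff H : frame_form u u = - frame_form u u.
  have /eqP : (2 : R) *: frame_form u u = 0.
    by rewrite scaler_nat mulr2n {2}H subrr.
  by rewrite scaler_eq0 pnatr_eq0 => /eqP.
rewrite {1}/frame_form; under eq_bigr do rewrite scaler_sumr.
rewrite exchange_big /frame_form -sumrN; apply: eq_bigr => i _.
rewrite -scalerN -sumrN scaler_sumr; apply: eq_bigr => l _.
by rewrite (curvature_skew hC (a i)) !scalerN !scalerA mulrC.
Qed.

Lemma frame_form_smooth (X Y : vector_field M) (g : Cinf M) :
  smooth_on setT (fun p => frame_form (X p) (Y p) g).
Proof.
pose th (Z : vector_field M) i : Cinf M :=
  \det G * \sum_j vf_apply Z (f j) * \adj G j i.
have thE (Z : vector_field M) i (p : M) : coframe i (Z p) = th Z i p.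
  rewrite /coframe [RHS]CinfME; congr (_ * _).
  by rewrite -[RHS]/(evalC p _) rmorph_sum.
have := CinfP (\sum_i th X i * \sum_l th Y l * vf_apply (curvature (a i) (a l)) g).
congr (smooth_on _ _); apply/funext => p.
rewrite -[LHS]/(evalC p _) rmorph_sum tangent_sumE; apply: eq_bigr => i _.
rewrite rmorphM tangentZE thE; congr (_ * _).
rewrite rmorph_sum tangent_sumE; apply: eq_bigr => l _.
by rewrite rmorphM tangentZE thE.
Qed.

Definition frame_tangent_form : tangent_form2 M :=
  TangentForm2 frame_form_linearl frame_form_linearr frame_form_alternating
    frame_form_smooth.

Lemma coframe_sum p (b : section A) :
  \sum_i coframe i (rho b p) *: rho (a i) p = (\det G) p ^+ 2 *: rho b p.
Proof.
have im (d : section A) : range (anchor A p) (rho d p) by exists (d p).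
have GE i j : map_mx (evalC p) G i j = differential (f j) p (rho (a i) p).
  by rewrite !mxE.
rewrite -[X in X ^+ 2]/(evalC p _) -det_map_mx.
rewrite -(cramer_span (hr p) (fun i => im (a i)) (im b) GE).
rewrite det_map_mx -map_mx_adj; apply: eq_bigr => i _; congr (_ *: _).
by congr (_ * _); apply: eq_bigr => j _; rewrite [map_mx _ _ _ _]mxE.
Qed.

Lemma frame_tangent_formE (b c : section A) p :
  frame_tangent_form p (rho b p) (rho c p) =
    (\det G) p ^+ 4 *: curvature b c p.
Proof.
have inner i : \sum_l coframe l (rho c p) *: curvature (a i) (a l) p =
    (\det G) p ^+ 2 *: curvature (a i) c p.
  have := curvature_tensorial hC (a i) (coframe_sum p c).
  rewrite curvature_skew// scalerN => /(congr1 -%R); rewrite opprK => <-.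
  rewrite -sumrN; apply: eq_bigr => l _.
  by rewrite -scalerN -curvature_skew.
rewrite /= /frame_form; under eq_bigr do rewrite inner scalerA mulrC -scalerA.
rewrite -scaler_sumr (curvature_tensorial hC c (coframe_sum p b)).
by rewrite scalerA -exprD.
Qed.

End LocalForm.

(** A nonvanishing determinant at [p0] requires a basis of the image of the
    anchor, lifted to sections, and functions on which it is nondegenerate. *)
Lemma frame_at (R : realType) (n : nat) (M : manifold R n)
    (A : algebroid_data M) (r : nat) (p0 : M) :
  has_dim (range (anchor A p0)) r ->
  exists (a : 'I_r -> section A) (f : 'I_r -> Cinf M),
    (\det (pairing_matrix a f)) p0 != 0.
Proof.
move=> [b [b_indep bS]].
have bE i : exists a : section A, rho a p0 = b i.
  have : range (anchor A p0) (b i).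
    rewrite bS; exists (fun j => (j == i)%:R) => //.
    rewrite (bigD1 i)//= eqxx scale1r big1 ?addr0// => j /negbTE ->.
    by rewrite scale0r.
  by move=> [e _ <-]; have [a <-] := section_through e; exists a.
have [a aE] := choice bE.
have [f f0] : exists f : 'I_r -> Cinf M,
    \det (\matrix_(i, j) rho (a i) p0 (f j)) != 0.
  apply: (@independent_dual R (Cinf M) r (fun i => rho (a i) p0)) => c c0.
  apply: b_indep; apply/val_inj/funext => g.
  rewrite [LHS]tangent_sumE; under eq_bigr do rewrite tangentZE -aE.
  exact: c0.
exists a, f; apply: contra_neq f0 => g0.
rewrite -[RHS]g0 -[RHS]/(evalC p0 _) -det_map_mx.
by congr (\det _); apply/matrixP => i j; rewrite !mxE.
Qed.

(** * Gluing by a locally finite sum *)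

Section Gluing.
Variables (R : realType) (n : nat) (M : manifold R n).

(** For each member of a countable basis that fits into some [V d], keep one such
    [d]; [d0] fills the remaining indices. *)
Lemma lindelof_sequence (D : Type) (d0 : D) (V : D -> set M) :
  (forall d, open (V d)) -> (forall p, exists d, V d p) ->
  exists s : nat -> D, forall p, exists k, V (s k) p.
Proof.
move=> oV covV; have [B /countable_injP[code code_inj] [_ Bbasis]] :=
  @manifold_second_countable _ _ M.
pose good k d := exists b, [/\ B b, code b = k & b `<=` V d].
have /choice[s sP] k : exists d, (exists e, good k e) -> good k d.
  by have [[e ge]|ne] := pselect (exists e, good k e); [exists e|exists d0].
exists s => p; have [d Vdp] := covV p.
have /Bbasis[b [Bb bp] bV] : nbhs p (V d).
  by apply: open_nbhs_nbhs; split.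
exists (code b); have [|b' [Bb' bb' b'V]] := sP (code b); first by exists d, b.
by apply: b'V; rewrite (code_inj _ _ _ _ bb') ?inE.
Qed.

Variables (S : nat -> tangent_form2 M) (w : nat -> Cinf M) (lam : nat -> R).
Hypothesis w_ge0 : forall k p, 0 <= w k p.
Hypothesis w_cover : forall p, exists k, 1 < lam k * w k p.

Fact cutoff_smooth k : smooth_on setT (fun p : M => flat 0 (1 - lam k * w k p)).
Proof.
apply: (@smooth_on_flat _ _ _ _ (fun p => 1 - lam k * w k p)); first exact: openT.
apply: smooth_onB; [exact: openT|exact: smooth_on_cst|].
exact: (CinfP (constC (lam k) * w k)).
Qed.

Definition cutoff k : Cinf M := mkCinf (cutoff_smooth k).

(** The product vanishes as soon as some earlier [lam j * w j] exceeds 1; this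
    is what makes sums weighted by [cutoff_prod] locally finite. *)
Definition cutoff_prod k : Cinf M := \prod_(j < k) cutoff j.

Lemma cutoff_prodE k p :
  cutoff_prod k p = \prod_(j < k) flat 0 (1 - lam j * w j p).
Proof. by rewrite -[LHS]/(evalC p _) rmorph_prod. Qed.

Lemma cutoff_prod_eq0 k m p :
  1 < lam m * w m p -> (m < k)%N -> cutoff_prod k p = 0.
Proof.
move=> wm mk; rewrite cutoff_prodE (bigD1 (Ordinal mk))//= flat_eq0 ?mul0r//.
by rewrite subr_le0 ltW.
Qed.

Lemma cutoff_prod_ge0 k p : 0 <= cutoff_prod k p.
Proof. by rewrite cutoff_prodE; apply: prodr_ge0 => j _; exact: flat_ge0. Qed.

(** Terms beyond [stop_index p] vanish at [p].  The index itself may jump from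
    point to point, but by [cutoff_sumE] any other admissible index gives the
    same sum. *)
Definition stop_index (p : M) : nat := projT1 (cid (w_cover p)).

Lemma stop_indexP p : 1 < lam (stop_index p) * w (stop_index p) p.
Proof. exact: (projT2 (cid (w_cover p))). Qed.

Definition cutoff_sum (V : lmodType R) (p : M) (z : nat -> V) : V :=
  \sum_(0 <= k < (stop_index p).+1) cutoff_prod k p *: z k.

Lemma cutoff_sumE (V : lmodType R) p (z : nat -> V) m : 1 < lam m * w m p ->
  cutoff_sum p z = \sum_(0 <= k < m.+1) cutoff_prod k p *: z k.
Proof.
have H i j : 1 < lam i * w i p -> (i <= j)%N ->
    \sum_(0 <= k < i.+1) cutoff_prod k p *: z k =
    \sum_(0 <= k < j.+1) cutoff_prod k p *: z k.
  move=> wi ij; rewrite [RHS](@big_cat_nat _ _ _ i.+1)//=.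
  rewrite [X in _ + X]big1_seq ?addr0//.
  move=> k; rewrite mem_index_iota => /andP[_ /andP[ik _]].
  by rewrite (cutoff_prod_eq0 wi ik) scale0r.
move=> wm; rewrite /cutoff_sum; case/orP: (leq_total (stop_index p) m) => [|lm].
  exact: H (stop_indexP p).
exact/esym/H.
Qed.

Lemma cutoff_sum_smooth (x : nat -> Cinf M) :
  smooth_on setT (fun p => cutoff_sum p (fun k => x k p : R^o)).
Proof.
apply: smooth_on_local => p _; pose m := stop_index p.
exists [set q | 1 < lam m * w m q].
have oV : open [set q | 1 < lam m * w m q].
  exact: (Cinf_gt_open (constC (lam m) * w m)).
split=> //; first exact: stop_indexP.
apply: (@eq_smooth_on _ _ _ _
   (\sum_(0 <= k < m.+1) cutoff_prod k * x k : Cinf M)) => //.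
  move=> q wm; rewrite (cutoff_sumE _ wm) -[LHS]/(evalC q _) rmorph_sum.
  by apply: eq_bigr => k _; rewrite rmorphM.
by apply: smooth_on_subset (CinfP _).
Qed.

Definition total_weight (p : M) : R := cutoff_sum p (fun k => w k p : R^o).

(** The term of the least [k] with [w k p != 0] is positive: all earlier cutoffs
    are equal to [flat 0 1] at [p]. *)
Lemma total_weight_gt0 p : 0 < total_weight p.
Proof.
have ex : exists k, w k p != 0.
  have [k wk] := w_cover p; exists k; apply: contraTneq wk => ->.
  by rewrite mulr0 ltr10.
have [k wk kmin] := ex_minnP ex.
have kl : (k <= stop_index p)%N.
  apply: kmin; apply: contraTneq (stop_indexP p) => ->.
  by rewrite mulr0 ltr10.
rewrite /total_weight /cutoff_sum big_mkord.
rewrite (bigD1 (Ordinal (kl : k < (stop_index p).+1)%N))//=.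
apply: ltr_pwDl.
  apply: mulr_gt0; last by rewrite lt0r wk w_ge0.
  rewrite lt0r cutoff_prod_ge0 andbT cutoff_prodE; apply/prodf_neq0 => j _.
  have -> : w j p = 0.
    apply: contraTeq (ltn_ord j) => /kmin; by rewrite -leqNgt.
  by rewrite mulr0 subr0 gt_eqF// flat0_gt0.
apply: sumr_ge0 => j _.
by apply: mulr_ge0; [exact: cutoff_prod_ge0|exact: w_ge0].
Qed.

Definition glued (p : M) (u v : tangent p) : tangent p :=
  (total_weight p)^-1 *: cutoff_sum p (fun k => S k p u v).

Lemma glued_linearl p (v : tangent p) : linear ((@glued p)^~ v).
Proof.
move=> c u u'; rewrite /glued /cutoff_sum scalerA mulrC -scalerA -scalerDr.
congr (_ *: _); rewrite scaler_sumr -big_split; apply: eq_bigr => k _ /=.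
by rewrite form2_linearl scalerDr !scalerA mulrC.
Qed.

Lemma glued_linearr p (u : tangent p) : linear (@glued p u).
Proof.
move=> c v v'; rewrite /glued /cutoff_sum scalerA mulrC -scalerA -scalerDr.
congr (_ *: _); rewrite scaler_sumr -big_split; apply: eq_bigr => k _ /=.
by rewrite form2_linearr scalerDr !scalerA mulrC.
Qed.

Lemma glued_alternating p (u : tangent p) : glued u u = 0.
Proof.
rewrite /glued /cutoff_sum big1 ?scaler0// => k _.
by rewrite form2_alternating scaler0.
Qed.

Lemma glued_smooth (X Y : vector_field M) (g : Cinf M) :
  smooth_on setT (fun p => glued (X p) (Y p) g).
Proof.
have s1 := smooth_on_inv openT (fun p _ => lt0r_neq0 (total_weight_gt0 p))
  (cutoff_sum_smooth w).
have s2 := cutoff_sum_smooth (fun k => vf_apply (form2_apply (S k) X Y) g).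
have := smooth_onM openT s1 s2; congr (smooth_on _ _); apply/funext => p.
rewrite /glued tangentZE /cutoff_sum tangent_sumE; congr (_ * _).
Qed.

Definition glued_form : tangent_form2 M :=
  TangentForm2 glued_linearl glued_linearr glued_alternating glued_smooth.

(** The value of [S k] is [t] up to the factor [w k p]; the same weights enter
    [total_weight], and dividing by it restores [t]. *)
Lemma glued_formE p (u v t : tangent p) :
  (forall k, S k p u v = w k p *: t) -> glued_form p u v = t.
Proof.
move=> St; rewrite /= /glued /cutoff_sum.
under eq_bigr do rewrite St scalerA.
rewrite -scaler_suml scalerA [X in X *: _]mulVf ?scale1r//.
exact: lt0r_neq0 (total_weight_gt0 p).
Qed.

End Gluing.

(** * Two-forms with values in the tangent bundle *)

Section TangentForms.
Variables (R : realType) (n : nat) (M : manifold R n).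
Implicit Types T : tangent_form2 M.

Lemma form2_ext T T' : (forall p u v, T p u v = T' p u v) -> T = T'.
Proof.
move=> TT'; have : form2_val T = form2_val T'.
  apply/functional_extensionality_dep => p.
  by apply/funext => u; apply/funext => v; exact: TT'.
case: T T' {TT'} => [t l r a s] [t' l' r' a' s'] /= tt'.
move: l r a s; rewrite tt' => l r a s.
by congr TangentForm2; exact: Prop_irrelevance.
Qed.

Lemma form2_0l T p (v : tangent p) : T p 0 v = 0.
Proof.
have := form2_linearl T v (-1) 0 0.
by rewrite /= scaler0 addr0 scaleN1r addNr.
Qed.

Lemma form2_skew T p (u v : tangent p) : T p v u = - T p u v.
Proof.
have := form2_alternating T (1 *: u + v).
rewrite form2_linearl !form2_linearr !form2_alternating !scale1r.
by rewrite add0r addr0 addrC => /eqP; rewrite addr_eq0 => /eqP.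
Qed.

End TangentForms.

Lemma rhoP (R : realType) (n : nat) (M : manifold R n) (A : algebroid_data M)
    (f : Cinf M) (a b : section A) p :
  rho (f *: a + b) p = f p *: rho a p + rho b p.
Proof. exact: (linearP (anchor A p)). Qed.

(** * The form of a curved Courant algebroid *)

(** Countably many frame forms, weighted by the fourth powers of the
    determinants of their frames, are glued together. *)
Lemma curvature_form (R : realType) (n : nat) (M : manifold R n)
    (A : algebroid_data M) (r : nat) : curved_courant A ->
  (forall p, has_dim (range (anchor A p)) r) ->
  exists T : tangent_form2 M, forall a b : section A,
    curvature a b = form2_apply T (rho a) (rho b).
Proof.
move=> hC hr.
(* Arbitrary sections and functions are admitted, even with a determinant that
   vanishes identically: each choice gives a valid pair of form and weight, and
   D is inhabited even when M is empty. *)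
pose D : Type := ('I_r -> section A) * ('I_r -> Cinf M) * R.
pose w (d : D) : Cinf M := (\det (pairing_matrix d.1.1 d.1.2)) ^+ 4.
have wE d p : w d p = (\det (pairing_matrix d.1.1 d.1.2)) p ^+ 4.
  by rewrite -[LHS]/(evalC p _) rmorphXn.
have [s s_cover] : exists s : nat -> D,
    forall p, exists k, 1 < (s k).2 * w (s k) p.
  apply: (@lindelof_sequence _ _ _ D (fun=> 0, fun=> 0, 0)
    (fun d => [set p | 1 < d.2 * w d p])) => [d|p].
    exact: (Cinf_gt_open (constC d.2 * w d)).
  have [a [f af0]] := frame_at (hr p).
  (* The constant 2 / w makes the scaled weight equal to 2 > 1 at p. *)
  exists (a, f, 2 / (\det (pairing_matrix a f)) p ^+ 4).
  by rewrite /mkset wE /= divfK ?ltr1n// expf_neq0.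
have w_ge0 k p : 0 <= w (s k) p by rewrite wE exprn_even_ge0.
exists (glued_form (fun k => frame_tangent_form hC (s k).1.1 (s k).1.2)
  w_ge0 s_cover).
move=> a b; apply: vf_ext => p; symmetry; apply: glued_formE => k.
by rewrite frame_tangent_formE// wE.
Qed.

(** * The equivalence and uniqueness *)

Theorem proposition2p15 (R : realType) (n : nat) (M : manifold R n)
    (A : algebroid_data M)
    (hA : metric_algebroid A) (hreg : regular_algebroid A) :
  (curved_courant A <->
     exists T : tangent_form2 M, forall a b : section A,
       curvature a b = form2_apply T (rho a) (rho b)) /\
  (curved_courant A -> transitive_algebroid A ->
     forall T T' : tangent_form2 M,
       (forall a b : section A,
          curvature a b = form2_apply T (rho a) (rho b)) ->
       (forall a b : section A,
          curvature a b = form2_apply T' (rho a) (rho b)) ->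
       T = T').
Proof.
split; first split.
- move=> hC; have [r hr] := hreg.
  exact: curvature_form hC hr.
- move=> [T TE]; split=> //.
  + move=> f a a' b; apply: vf_ext => p; rewrite !TE.
    by rewrite -[LHS]/(T p (rho _ p) (rho _ p)) rhoP form2_linearl.
  + move=> f a b b'; apply: vf_ext => p; rewrite !TE.
    by rewrite -[LHS]/(T p (rho _ p) (rho _ p)) rhoP form2_linearr.
  + by move=> a b; apply: vf_ext => p; rewrite !TE; exact: form2_skew.
  + move=> a b p a0; rewrite TE.
    rewrite -[LHS]/(T p (anchor A p (a p)) (rho b p)) a0.
    exact: form2_0l.
- move=> _ htr T T' TE TE'; apply: form2_ext => p u v.
  have lift (x : tangent p) : exists a : section A, rho a p = x.
    have [e _ <-] : range (anchor A p) x by rewrite htr.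
    by have [a <-] := section_through e; exists a.
  have [[a <-] [b <-]] := (lift u, lift v).
  have /(congr1 (fun X : vector_field M => X p)) := TE' a b.
  by rewrite TE.
Qed.
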